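(* Let $I \subset \mathbb{R}$ be an open interval. The family of all quasi-arithmetic means $A^{[f]}$ on $I$ generated by strictly monotone functions $f \colon I \to \mathbb{R}$ that are differentiable on $I$ is an interval-type set in the family of all quasi-arithmetic means on $I$.
   Context: For an interval $I\subset\mathbb{R}$ and a continuous, strictly monotone function $f \colon I \to \mathbb{R}$, the quasi-arithmetic mean generated by $f$ is the function $A^{[f]} \colon \bigcup_{n=1}^\infty I^n \to I$, $A^{[f]}(a_1,\dots,a_n) := f^{-1}\left(\frac{f(a_1)+\cdots+f(a_n)}{n}\right)$. For two such functions $f,g$ on the same interval $I$, $A^{[f]} \le A^{[g]}$ means $A^{[f]}(a) \le A^{[g]}(a)$ for all $a \in \bigcup_{n=1}^\infty I^n$. A set $\mathcal{I}$ of quasi-arithmetic means on $I$ is called an interval-type set (or interval) if, whenever $A^{[f]}, A^{[g]} \in \mathcal{I}$ and $A^{[h]}$ is a quasi-arithmetic mean on $I$ (with $h$ an arbitrary continuous, strictly monotone function on $I$) such that $A^{[f]} \le A^{[h]} \le A^{[g]}$, then $A^{[h]} \in \mathcal{I}$. The derivative of a differentiable generator is allowed to vanish at some points. *)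

(* Defs.v *)
From HB Require Import structures.
From mathcomp Require Import all_boot all_order all_algebra.
From mathcomp Require Import all_classical all_reals all_analysis.

Set Implicit Arguments.
Unset Strict Implicit.
Unset Printing Implicit Defensive.
Import Order.TTheory GRing.Theory Num.Theory.
Import numFieldNormedType.Exports.
Local Open Scope classical_set_scope.
Local Open Scope ring_scope.

(* Functions on I are total functions R -> R used only through their values
   on I. *)
Definition strictly_monotone (R : realType) (I : set R) (f : R -> R) : Prop :=
  {in I &, {homo f : x y / x < y}} \/ {in I &, {homo f : x y /~ x < y}}.

Definition generator (R : realType) (I : set R) (f : R -> R) : Prop :=
  {within I, continuous f} /\ strictly_monotone I f.

(* The union of the I^n for n >= 1. *)
Definition tuples (R : realType) (I : set R) : set (seq R) :=
  [set a | a <> [::] /\ forall x, x \in a -> I x].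

(* [pinv I f] is the inverse of f : I -> f(I). The restriction to [tuples I]
   makes the equality of two means as total functions coincide with their
   equality as functions on the union of the I^n. *)
Definition qa_mean (R : realType) (I : set R) (f : R -> R) : seq R -> R :=
  (fun a => pinv I f ((\sum_(x <- a) f x) / (size a)%:R)) \_ (tuples I).

Definition mean_le (R : realType) (I : set R) (M N : seq R -> R) : Prop :=
  forall a, tuples I a -> M a <= N a.

Definition qa_means (R : realType) (I : set R) : set (seq R -> R) :=
  [set qa_mean I f | f in [set f | generator I f]].

Definition diff_qa_means (R : realType) (I : set R) : set (seq R -> R) :=
  [set qa_mean I f | f in
    [set f | strictly_monotone I f /\ forall x, I x -> derivable f x 1]].

Definition interval_type (R : realType) (I : set R)
    (F : set (seq R -> R)) : Prop :=
  F `<=` qa_means I /\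
  forall L M N, F L -> F N -> qa_means I M ->
    mean_le I L M -> mean_le I M N -> F M.

Lemma exists_le_avg (R : realType) (f : R -> R) (a : seq R) : a <> [::] ->
  exists2 x, x \in a & f x <= (\sum_(x <- a) f x) / (size a)%:R.
Proof.
move=> a0; have sa : 0 < (size a)%:R :> R by rewrite ltr0n; case: a a0.
set v := (_ / _); apply: contrapT => H.
have vf x : x \in a -> v < f x.
  by move=> xa; rewrite ltNge; apply/negP => fxv; apply: H; exists x.
have : \sum_(x <- a) v < \sum_(x <- a) f x.
  rewrite big_seq [ltRHS]big_seq; apply: ltr_sum => //.
  by case: a a0 {sa v H vf} => //= x a _; rewrite inE eqxx.
by rewrite big_const_seq count_predT iter_addr addr0 -mulr_natr divfK ?ltxx ?gt_eqF.
Qed.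

Lemma exists_ge_avg (R : realType) (f : R -> R) (a : seq R) : a <> [::] ->
  exists2 x, x \in a & (\sum_(x <- a) f x) / (size a)%:R <= f x.
Proof.
move=> /(exists_le_avg (fun x => - f x)) [x xa].
by rewrite sumrN mulNr lerN2 => h; exists x.
Qed.

Lemma qa_meanP (R : realType) (I : set R) (f : R -> R) (a : seq R) :
  is_interval I -> generator I f -> tuples I a ->
  I (qa_mean I f a) /\ f (qa_mean I f a) = (\sum_(x <- a) f x) / (size a)%:R.
Proof.
move=> Iitv [fc _] Ia; rewrite /qa_mean patchE mem_set //.
set v := (X in pinv I f X).
suff vI : (f @` I) v.
  split; last by rewrite pinvK ?inE.
  by apply: (@surjpinv_image_sub _ _ (fun=> point) I (f @` I) f) => //; exists v.
have [a0 aI] := Ia.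
have [x xa fxv] := exists_le_avg f a0.
have [y ya vfy] := exists_ge_avg f a0.
have sub s t : I s -> I t -> {within `[s, t], continuous f}.
  move=> Is It; apply: continuous_subspaceW fc => z /=.
  by rewrite in_itv /=; exact: Iitv.
have [xy|/ltW yx] := leP x y.
- have [|c cxy fc'] := IVT xy (sub _ _ (aI _ xa) (aI _ ya)) (v := v).
    by rewrite ge_min le_max fxv vfy orbT.
  by exists c => //; move: cxy; rewrite in_itv /=; apply: Iitv; exact: aI.
- have [|c cxy fc'] := IVT yx (sub _ _ (aI _ ya) (aI _ xa)) (v := v).
    by rewrite ge_min le_max fxv vfy orbT.
  by exists c => //; move: cxy; rewrite in_itv /=; apply: Iitv; exact: aI.
Qed.

(* Main.v *)
(** Up to sign the generators [f], [h], [g] are increasing, and the hypotheses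
    say that [h] is convex as a function of [f] and [g] is convex as a function
    of [h]. At a point of [I] let [S] and [T] be the difference quotients of [h]
    with respect to [f] and of [g] with respect to [h]; both are positive and
    can only jump upwards there. If [f' = 0], then [S] is locally bounded and
    [h' = 0]. If [f' > 0], then [S * T] converges to [g' / f'], so neither factor
    jumps, [S] converges, and [h] is differentiable. Hence every increasing
    generator of the intermediate mean is itself differentiable. *)

Require Import Defs.
From mathcomp Require Import all_boot all_order all_algebra.
From mathcomp Require Import all_classical all_reals all_analysis.
From mathcomp Require Import ring lra.
Set Implicit Arguments.
Unset Strict Implicit.
Unset Printing Implicit Defensive.
Import Order.TTheory GRing.Theory Num.Theory.
Import numFieldNormedType.Exports.
Local Open Scope classical_set_scope.
Local Open Scope ring_scope.

Lemma strictly_monotone_inj (R : realType) (I : set R) (f : R -> R) :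
  strictly_monotone I f -> {in I &, injective f}.
Proof.
case=> fm x y xI yI fxy; case: (ltgtP x y) => // xy.
- by have := fm _ _ xI yI xy; rewrite fxy ltxx.
- by have := fm _ _ yI xI xy; rewrite fxy ltxx.
- by have := fm _ _ yI xI xy; rewrite fxy ltxx.
- by have := fm _ _ xI yI xy; rewrite fxy ltxx.
Qed.

Lemma generatorN (R : realType) (I : set R) (f : R -> R) :
  generator I f -> generator I (\- f).
Proof.
move=> [fc fm]; split; first by move=> x; apply: cvgN; exact: fc.
by case: fm => fm; [right|left] => x y xI yI xy; rewrite /= ltrN2; exact: fm.
Qed.

Lemma qa_meanN (R : realType) (I : set R) (f : R -> R) :
  is_interval I -> generator I f -> qa_mean I (\- f) = qa_mean I f.
Proof.
move=> Iitv fg; apply/funext => a.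
have [Ia|nIa] := pselect (tuples I a); last first.
  by rewrite /qa_mean !patchE memNset.
have [I1 E1] := qa_meanP Iitv fg Ia.
have [I2 E2] := qa_meanP Iitv (generatorN fg) Ia.
apply: (strictly_monotone_inj fg.2); rewrite ?inE //.
by apply: oppr_inj; rewrite E1 [LHS]E2 sumrN mulNr.
Qed.

(** Negating a decreasing generator changes neither its mean nor its differentiability, so every
    comparison below may assume increasing generators. *)
Lemma increasing_generator (R : realType) (I : set R) (f : R -> R) :
  is_interval I -> generator I f ->
  exists e : R -> R, [/\ generator I e, {in I &, {homo e : x y / x < y}},
    qa_mean I e = qa_mean I f & forall x, derivable f x 1 -> derivable e x 1].
Proof.
move=> Iitv fg; have [fi|fd] := fg.2; first by exists f.
exists (\- f); split => //; first exact: generatorN.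
- by move=> x y xI yI xy; rewrite /= ltrN2; exact: fd.
- exact: qa_meanN.
- by move=> x; exact: derivableN.
Qed.

Lemma derivable_generator (R : realType) (I : set R) (f : R -> R) :
  strictly_monotone I f -> (forall x, I x -> derivable f x 1) ->
  generator I f.
Proof.
move=> fm fd; split=> //; apply: continuous_in_subspaceT => x /[1!inE] Ix.
by apply/differentiable_continuous/derivable1_diffP/fd.
Qed.

(** Supplies the multiplicity [k] of an entry in a tuple of length [n]. Once [n > 1 / (b - a)], the
    integer part [k] of [b * n] exceeds [b * n - 1 > a * n]. *)
Lemma exists_nat_frac (R : realType) (a b : R) : 0 <= a -> a < b -> b <= 1 ->
  exists k n : nat, [/\ (0 < n)%N, (k <= n)%N, a * n%:R < k%:R & k%:R <= b * n%:R].
Proof.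
move=> a0 ab b1; have ba : 0 < b - a by lra.
pose n := (Num.truncn (b - a)^-1).+1.
have nE : (b - a)^-1 < n%:R by exact: truncnS_gt.
have n1 : 1 < n%:R * (b - a) by rewrite -ltr_pdivrMr // mul1r.
have n0 : 0 < n%:R :> R by rewrite ltr0n.
have bn0 : 0 <= b * n%:R by apply: mulr_ge0; [lra|exact: ltW].
have /andP[kb bk] := truncn_itv bn0.
exists (Num.truncn (b * n%:R)), n; split => //.
- by rewrite -(@ler_nat R) (le_trans kb)// ler_piMl // ltW.
- by rewrite -natr1 in bk; nra.
Qed.

(* The conclusion is the convexity of [h \o f^-1]. Monotonicity of [f] and [h]
   suffices to pass from rational to real weights. *)
Lemma mean_le_chord (R : realType) (I : set R) (f h : R -> R) :
  is_interval I -> generator I f -> generator I h ->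
  {in I &, {homo f : x y / x < y}} -> {in I &, {homo h : x y / x < y}} ->
  mean_le I (qa_mean I f) (qa_mean I h) ->
  forall x y z, I x -> I z -> x < y -> y < z ->
  (h y - h x) * (f z - f x) <= (h z - h x) * (f y - f x).
Proof.
move=> Iitv fg hg fi hi fh x y z Ix Iz xy yz.
have Iy : I y by apply: (Iitv x z) => //; rewrite !ltW.
have xz := lt_trans xy yz.
have inI t : I t -> t \in I by rewrite inE.
have := fi _ _ (inI _ Ix) (inI _ Iy) xy; have := fi _ _ (inI _ Iy) (inI _ Iz) yz.
have := hi _ _ (inI _ Ix) (inI _ Iy) xy; have := hi _ _ (inI _ Iy) (inI _ Iz) yz.
move=> hyz hxy fyz fxy.
have hxz : 0 < h z - h x by lra.
have fxz : 0 < f z - f x by lra.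
rewrite leNgt; apply/negP => H.
(* The two bounds are the weights of [x] for which the weighted [h]-mean, respectively [f]-mean, of
   [x] and [z] equals [y]; [H] puts the first below the second. With a weight [k / n] between them,
   the [f]-mean is at least [y] and the [h]-mean is below [y], against [fh]. *)
have [|||k [n [n0 kn kmu klam]]] := @exists_nat_frac R
    ((h z - h y) / (h z - h x)) ((f z - f y) / (f z - f x)) _ _.
- by rewrite divr_ge0 //; lra.
- by rewrite ltr_pdivrMr // mulrAC ltr_pdivlMr //; lra.
- by rewrite ler_pdivrMr //; lra.
pose a := nseq k x ++ nseq (n - k) z.
have sa : size a = n by rewrite size_cat !size_nseq subnKC.
have Ia : tuples I a.
  split; first by move/(congr1 size); rewrite sa /=; case: (n) n0.
  by move=> t; rewrite mem_cat !mem_nseq => /orP[] /andP[_ /eqP->].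
have avgE (e : R -> R) : n%:R * ((\sum_(t <- a) e t) / (size a)%:R) =
    n%:R * e z - k%:R * (e z - e x).
  rewrite sa mulrC divfK ?pnatr_eq0 -?lt0n // big_cat /= !big_nseq !iter_addr !addr0.
  rewrite mulrnBr // -[e x *+ k]mulr_natl -[e z *+ k]mulr_natl -[e z *+ n]mulr_natl.
  by ring.
have [Iw fw] := qa_meanP Iitv fg Ia.
have [Iv hv] := qa_meanP Iitv hg Ia.
have := fh _ Ia; have := avgE f; have := avgE h; rewrite -fw -hv.
move: (qa_mean I f a) (qa_mean I h a) Iw Iv => w v Iw Iv hvE fwE wv.
have nR : 0 < n%:R :> R by rewrite ltr0n.
have mono (e : R -> R) : {in I &, {homo e : x y / x < y}} ->
    forall s t, I s -> I t -> s <= t -> e s <= e t.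
  by move=> ei s t Is It; rewrite le_eqVlt => /predU1P[->//|st]; apply/ltW/ei; rewrite ?inE.
have fyw : f y <= f w.
  rewrite -(ler_pM2l nR) fwE.
  by move: klam; rewrite mulrAC ler_pdivlMr //; lra.
have yw : y <= w.
  by rewrite leNgt; apply/negP => wy; have := fi _ _ (inI _ Iw) (inI _ Iy) wy; lra.
have : h y <= h v by exact: (mono h hi _ _ Iy Iv (le_trans yw wv)).
rewrite -(ler_pM2l nR) hvE.
by move: kmu; rewrite mulrAC ltr_pdivrMr //; lra.
Qed.

(* [S] and [T] can only jump upwards at [0], so their product can only be
   continuous there if neither jumps. *)
Lemma cvg_factor_dnbhs0 (R : realType) (S T : R -> R) (d c : R) : 0 < d ->
  (forall s t, - d < s -> s < 0 -> 0 < t -> t < d -> S s <= S t) ->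
  (forall s t, - d < s -> s < 0 -> 0 < t -> t < d -> T s <= T t) ->
  (forall t, t != 0 -> `|t| < d -> 0 < S t /\ 0 < T t) ->
  S t * T t @[t --> 0^'] --> c -> cvg (S t @[t --> 0^']).
Proof.
move=> d0 Smono Tmono ST0 STc.
(* [L] separates the values of [S] left of [0] from those right of [0], so it is the limit as soon
   as [S t - S s] becomes small for [s < 0 < t]. *)
pose L := sup [set S s | s in [set s | - d < s < 0]].
have dd : - d < - (d / 2) < 0 by apply/andP; split; lra.
have SL s : - d < s -> s < 0 -> S s <= L.
  move=> ds s0; apply: ub_le_sup; last by exists s => //=; rewrite ds s0.
  by exists (S (d / 2)) => _ [r /= /andP[dr r0] <-]; apply: Smono => //; lra.
have LS t : 0 < t -> t < d -> L <= S t.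
  move=> t0 td; apply: ge_sup; first by exists (S (- (d / 2))), (- (d / 2)).
  by move=> _ [r /= /andP[dr r0] <-]; apply: Smono.
(* A positive lower bound of [T] to the right of [0]. It turns a bound on the jump of the product
   into one on the jump of [S]: [(S t - S s) * tau <= S t * T t - S s * T s]. *)
pose tau := T (- (d / 2)).
have tau0 : 0 < tau.
  by apply: (ST0 _ _ _).2; [lra|rewrite normrN gtr0_norm; lra].
have Ttau t : 0 < t -> t < d -> tau <= T t.
  by move=> t0 td; apply: Tmono => //; lra.
apply/cvg_ex; exists L; apply/cvgrPdist_le => /= e e0.
have et : 0 < e * tau / 2 by rewrite divr_gt0 // mulr_gt0.
move/cvgrPdist_le : STc => /(_ _ et)/nbhs_ballP[r /= r0 STr].
pose m := Num.min r d.
have m0 : 0 < m by rewrite lt_min r0.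
have key s t : - m < s -> s < 0 -> 0 < t -> t < m -> S t - S s <= e.
  rewrite ltrNl !lt_min => /andP[sr sd] s0 t0 /andP[tr td].
  have Ss := STr s; have St := STr t; move: Ss St.
  rewrite /ball/= !sub0r !normrN (gtr0_norm t0) (ltr0_norm s0).
  move=> /(_ sr (ltr0_neq0 s0)) + /(_ tr (lt0r_neq0 t0)).
  rewrite !ler_norml => /andP[s1 s2] /andP[t1 t2].
  have Sst : S s <= S t by apply: Smono => //; lra.
  have Tst : T s <= T t by apply: Tmono => //; lra.
  have Tt := Ttau t t0 td.
  have [S0 _] : 0 < S s /\ 0 < T s.
    by apply: ST0; rewrite ?ltr0_neq0 // ltr0_norm; lra.
  have : (S t - S s) * tau <= e * tau.
    apply: (@le_trans _ _ ((S t - S s) * T t)); first by apply: ler_wpM2l => //; lra.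
    have : S s * T s <= S s * T t by apply: ler_wpM2l => //; lra.
    lra.
  by rewrite ler_pM2r.
apply/nbhs_ballP; exists m => //= t.
rewrite /ball/= sub0r normrN => tm tn0.
(* [m / 2] and [- (m / 2)] serve as the partner of [t] on the other side of [0]; [L] lies between
   the two values of [S]. *)
have m2 : 0 < m / 2 < m by apply/andP; split; lra.
have md : m <= d by rewrite ge_min lexx orbT.
move: tm; rewrite ltr_norml => /andP[mt tm].
rewrite ler_norml; case: (ltgtP t 0) tn0 => [tneg _|tpos _|//].
- have := SL t; have := LS (m / 2); have := key t (m / 2).
  move=> /(_ mt tneg ltac:(lra) ltac:(lra)) k.
  move=> /(_ ltac:(lra) ltac:(lra)) + /(_ ltac:(lra) tneg).
  by move=> k1 k2; apply/andP; split; lra.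
- have := SL (- (m / 2)); have := LS t; have := key (- (m / 2)) t.
  move=> /(_ ltac:(lra) ltac:(lra) tpos tm) k.
  move=> /(_ tpos ltac:(lra)) + /(_ ltac:(lra) ltac:(lra)).
  by move=> k1 k2; apply/andP; split; lra.
Qed.

Lemma derivable_between (R : realType) (I : set R) (f g h : R -> R) (x0 : R) :
  open I ->
  {in I &, {homo f : x y / x < y}} -> {in I &, {homo g : x y / x < y}} ->
  {in I &, {homo h : x y / x < y}} ->
  (forall x y z, I x -> I z -> x < y -> y < z ->
    (h y - h x) * (f z - f x) <= (h z - h x) * (f y - f x)) ->
  (forall x y z, I x -> I z -> x < y -> y < z ->
    (g y - g x) * (h z - h x) <= (g z - g x) * (h y - h x)) ->
  I x0 -> derivable f x0 1 -> derivable g x0 1 -> derivable h x0 1.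
Proof.
move=> Iopen fi gi hi fh hg Ix0.
have /nbhs_ballP[d /= d0 dI] : nbhs x0 I by exact: open_nbhs_nbhs.
have It t : `|t| < d -> I (t + x0).
  by move=> td; apply: dI; rewrite /ball/= opprD addrC subrK normrN.
pose D (e : R -> R) t := e (t + x0) - e x0.
pose q e t := t^-1 * D e t.
have qE e : (fun t => t^-1 *: ((e \o shift x0) (t *: 1) - e x0)) = q e.
  by apply/funext => t; rewrite /q /D /= /shift /= [t *: 1]mulr1.
rewrite /derivable !qE => /cvg_ex[/= p qfp] /cvg_ex[/= r qgr].
have Dpos (e : R -> R) : {in I &, {homo e : x y / x < y}} ->
    forall t, 0 < t -> t < d -> 0 < D e t.
  move=> ei t t0 td; rewrite subr_gt0 ei ?inE ?ltrDr //.
  by apply: It; rewrite gtr0_norm.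
have Dneg (e : R -> R) : {in I &, {homo e : x y / x < y}} ->
    forall t, - d < t -> t < 0 -> D e t < 0.
  move=> ei t td t0; rewrite subr_lt0 ei ?inE ?gtrDr //.
  by apply: It; rewrite ltr0_norm // ltrNl.
have Dneq0 (e : R -> R) : {in I &, {homo e : x y / x < y}} ->
    forall t, t != 0 -> `|t| < d -> D e t != 0.
  move=> ei t; rewrite ltr_norml => + /andP[td1 td2].
  case: (ltgtP t 0) => [t0|t0|//] _; first by rewrite ltr0_neq0 ?Dneg.
  by rewrite lt0r_neq0 ?Dpos.
have ratio_gt0 (e k : R -> R) : {in I &, {homo e : x y / x < y}} ->
    {in I &, {homo k : x y / x < y}} ->
    forall t, t != 0 -> `|t| < d -> 0 < D k t / D e t.
  move=> ei ki t; rewrite ltr_norml => + /andP[td1 td2].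
  case: (ltgtP t 0) => [t0|t0|//] _; last by rewrite divr_gt0 ?Dpos.
  by rewrite nmulr_rgt0 ?invr_lt0 ?Dneg.
have ratio_le (e k : R -> R) : {in I &, {homo e : x y / x < y}} ->
    (forall x y z, I x -> I z -> x < y -> y < z ->
      (k y - k x) * (e z - e x) <= (k z - k x) * (e y - e x)) ->
    forall s t, - d < s -> s < 0 -> 0 < t -> t < d ->
    D k s / D e s <= D k t / D e t.
  move=> ei ek s t ds s0 t0 td.
  have Is : I (s + x0) by apply: It; rewrite ltr0_norm // ltrNl.
  have Itt : I (t + x0) by apply: It; rewrite gtr0_norm.
  (* Comparing the left chord with the whole chord amounts to comparing it with the right one. *)
  have := ek (s + x0) x0 (t + x0) Is Itt; rewrite gtrDr ltrDr.
  move=> /(_ s0 t0).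
  have := Dneg _ ei _ ds s0; have := Dpos _ ei _ t0 td; rewrite /D => et es.
  rewrite ler_pdivlMr // mulrAC ler_ndivrMr //; lra.
have near_d (P : R -> Prop) : (forall t, t != 0 -> `|t| < d -> P t) ->
    \forall t \near 0^', P t.
  move=> H; apply/nbhs_ballP; exists d => //= t.
  by rewrite /ball/= sub0r normrN => td t0; exact: H.
have qhE t : t != 0 -> `|t| < d -> D h t / D f t * q f t = q h t.
  by move=> t0 td; rewrite /q mulrCA divfK // Dneq0.
have [p0|p0] := eqVneq p 0.
  (* The value of [D h / D f] at [d / 2] bounds it at all nonzero [t] with [|t| < d / 2]: for
     [t < 0] by the upward jump, for [t > 0] by convexity at [x0], [t + x0], [d / 2 + x0]. Hence
     [q h] is squeezed between [0] and a multiple of [q f]. *)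
  have b0 : 0 < d / 2 < d by apply/andP; split; lra.
  have [b1 b2] := andP b0.
  apply/cvg_ex; exists 0; apply: (@squeeze_cvgr _ _ _ _ (cst 0)
    (fun t => D h (d / 2) / D f (d / 2) * q f t)); last first.
  - move: qfp; rewrite p0 => /(cvgM (cvg_cst (D h (d / 2) / D f (d / 2)))).
    by rewrite mulr0.
  - exact: cvg_cst.
  - apply/nbhs_ballP; exists (d / 2) => //= t.
    rewrite /ball/= sub0r normrN => td t0.
    have td' := lt_trans td b2.
    have qf0 : 0 <= q f t.
      move: td'; rewrite /q ltr_norml => /andP[dt td'].
      case: (ltgtP t 0) t0 => [tn|tp|//] _.
        by rewrite ltW // nmulr_rgt0 ?invr_lt0 ?Dneg.
      by rewrite ltW // mulr_gt0 ?invr_gt0 ?Dpos.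
    rewrite -qhE // mulr_ge0 ?(ltW (ratio_gt0 _ _ _ _ _ _ _)) //=.
    apply: ler_wpM2r => //.
    move: td td'; rewrite !ltr_norml => /andP[dt td] /andP[dt' td'].
    case: (ltgtP t 0) t0 => [tn|tp|//] _; first exact: ratio_le.
    rewrite ler_pdivlMr ?Dpos // mulrAC ler_pdivrMr ?Dpos //.
    apply: fh => //; rewrite ?ltrDr ?ltrD2r //.
    by apply: It; rewrite gtr0_norm.
have : cvg ((D h t / D f t) @[t --> 0^']).
  (* The increments of [h] cancel in the product, leaving [q g / q f], which tends to [r / p]. *)
  apply: (@cvg_factor_dnbhs0 _ _ (fun t => D g t / D h t) d (r / p) d0).
  - exact: ratio_le.
  - exact: ratio_le.
  - by move=> t t0 td; split; exact: ratio_gt0.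
  - apply: cvg_trans (cvgM qgr (cvgV p0 qfp)); apply: near_eq_cvg.
    apply: near_d => t t0 td; rewrite /q /=.
    have := Dneq0 _ hi t t0 td; have := Dneq0 _ fi t t0 td => f0 h0.
    by field; rewrite t0 f0 h0.
move=> /cvg_ex[/= l Sl]; apply/cvg_ex; exists (l * p).
apply: cvg_trans (cvgM Sl qfp); apply: near_eq_cvg.
by apply: near_d => t t0 td; rewrite /= qhE.
Qed.

Theorem corollary9 (R : realType) (I : set R)
  (Iopen : open I) (Iitv : is_interval I) :
  interval_type I (diff_qa_means I).
Proof.
split.
  by move=> _ [f [fm fd] <-]; exists f => //; exact: derivable_generator.
move=> _ M _ [f [fm fd] <-] [g [gm gd] <-] [h hgen <-].
have [f' [f'g f'i <- fd']] := increasing_generator Iitv (derivable_generator fm fd).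
have [g' [g'g g'i <- gd']] := increasing_generator Iitv (derivable_generator gm gd).
have [h' [h'g h'i <- _]] := increasing_generator Iitv hgen.
move=> fh hg; exists h' => //; split; first exact: h'g.2.
move=> x Ix; apply: (@derivable_between _ I f' g') => //.
- exact: mean_le_chord fh.
- exact: mean_le_chord hg.
- exact/fd'/fd.
- exact/gd'/gd.
Qed.
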